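(* Let $m\ge1$ and let $Q=Q_{\mathcal T,m}$ be the quiver associated with an ideal triangulation $\mathcal T$ (satisfying the conditions in the context) of a marked surface. If two generic potentials on $Q$ are right-equivalent, then their projections $\pi_{\mathrm{prim}}$ onto the space of primitive potentials are also right-equivalent. In other words, the class of the primitive part $\pi_{\mathrm{prim}}(W)$ of a generic potential $W$, in the quotient of the space of primitive potentials by the group of right-equivalences preserving this space, is an invariant of the action of right-equivalences on generic potentials.
   Context: **Surface and triangulation.** $\mathbb S$ is a compact oriented surface of genus $g$ with $d>0$ marked points (punctures), $2-2g-d<0$. An ideal arc is a non-selfintersecting curve with endpoints at marked points, up to isotopy relative to the marked points, which is not a contractible loop on the surface minus the marked points. An ideal triangulation $\mathcal T$ is a maximal collection of pairwise different non-intersecting ideal arcs; its complement is a union of triangles. It is assumed that no arc of $\mathcal T$ has coinciding endpoints and every marked point has valence at least $3$. **Quiver $Q_{\mathcal T,m}$.** Let $\Delta=\{(x,y,z)\in\mathbb R_{\ge0}^3: x+y+z=m+1\}$, oriented. The standard quiver in $\Delta$ has as vertices the integral points of $\Delta$ other than its three corners. For each triple of non-negative integers $(a,b,c)$ with $a+b+c=m-1$, take the ''black'' triangle with vertices $(a,b+1,c+1),(a+1,b,c+1),(a+1,b+1,c)$ and orient its three edges counterclockwise; these are the arrows. $Q_{\mathcal T,m}$, embedded in $\mathbb S$, is obtained by identifying every triangle of $\mathcal T$ with $\Delta$ (orientation-preservingly, compatibly along common edges) and gluing the copies of the standard quiver, identifying the $m$ vertices on each edge shared by two triangles. **Potentials.**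 $\mathbf k$ is a field of characteristic zero, $Q=(Q_0,Q_1,s,t)$ a finite quiver, $R=\bigoplus_{i\in Q_0}\mathbf k e_i$, $A$ the span of $Q_1$, with $R$-bimodule structure $e_i\alpha=\delta_{i,t(\alpha)}\alpha$, $\alpha e_j=\delta_{s(\alpha),j}\alpha$ (so in a path $\alpha_1\cdots\alpha_n$ the arrow $\alpha_n$ is traversed first and $s(\alpha_i)=t(\alpha_{i+1})$). $R\langle\langle Q\rangle\rangle$ is the path algebra completed with respect to path length. A potential is a possibly infinite $\mathbf k$-linear combination of cyclic paths, considered up to cyclic shift. A right-equivalence is an automorphism $\varphi$ of $R\langle\langle Q\rangle\rangle$ with $\varphi|_R=\mathrm{id}$ (determined by $\varphi|_A=\varphi^{\mathrm{diag}}+\varphi^{\mathrm{un}}$, with $\varphi^{\mathrm{diag}}:A\to A$ an $R$-bimodule isomorphism and $\varphi^{\mathrm{un}}$ an $R$-bimodule map from $A$ to the span of paths of length $\ge2$); it acts on potentials, and $W,W'$ are right-equivalent if $\varphi(W)=W'$ for some right-equivalence $\varphi$. **Primitive and generic potentials.** A chord of a cycle $\alpha_1\cdots\alpha_n$ is a triple $(\beta,i,j)$ with $\beta\in Q_1$, $i\ne j$, $t(\beta)=t(\alpha_i)$, $s(\beta)=s(\alpha_j)$; a cycle without chords is chordless. A potential is primitive if it is a linear combination of chordless cycles in which every chordless cycle has nonzero coefficient. The primitive part $\pi_{\mathrm{prim}}(W)$ of a potential $W$ is its projection to the span of chordless cycles. $W$ is generic if $\pi_{\mathrm{prim}}(W)$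 is a primitive potential. *)

(* Defs.v *)
From HB Require Import structures.
From mathcomp Require Import all_boot all_order all_algebra.
From mathcomp Require Import boolp.

Set Implicit Arguments.
Unset Strict Implicit.
Unset Printing Implicit Defensive.

Import GRing.Theory.

Record quiver := Quiver {
  qvert : finType;
  qarr : finType;
  src : qarr -> qvert;
  tgt : qarr -> qvert }.

(* [composable i w], w = a_1 ... a_n, says that a_1 ... a_n is a path ending
   at i in the right-to-left convention: t(a_1) = i and s(a_l) = t(a_{l+1}),
   so a_n is traversed first. *)
Fixpoint composable (Q : quiver) (i : qvert Q) (w : seq (qarr Q)) : bool :=
  if w is a :: w' then (tgt a == i) && composable (src a) w' else true.

(* The path (i, a_1 ... a_n) ends at i; (i, [::]) is the lazy path e_i. *)
Record qpath (Q : quiver) := QPath {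
  pword :> qvert Q * seq (qarr Q);
  pwordP : composable pword.1 pword.2 }.

HB.instance Definition _ (Q : quiver) := [isSub for @pword Q].
HB.instance Definition _ (Q : quiver) := [Choice of qpath Q by <:].

Section Paths.
Variable Q : quiver.
Implicit Types (i : qvert Q) (w : seq (qarr Q)) (p : qpath Q).

Definition ptgt p : qvert Q := (pword p).1.
Definition parr p : seq (qarr Q) := (pword p).2.
Definition psrc p : qvert Q := last (ptgt p) (map (@src Q) (parr p)).
Definition plen p : nat := size (parr p).

Definition lazy i : qpath Q :=
  @QPath Q (i, [::]) isT.

Lemma composable_cat i w1 w2 :
  composable i (w1 ++ w2) =
  composable i w1 && composable (last i (map (@src Q) w1)) w2.
Proof. by elim: w1 i => //= a w1 IH i; rewrite IH andbA. Qed.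

Fact ptake_subproof n p : composable (ptgt p) (take n (parr p)).
Proof.
by move: (pwordP p); rewrite -[X in composable _ X](cat_take_drop n)
  composable_cat => /andP[].
Qed.

Fact pdrop_subproof n p :
  composable (last (ptgt p) (map (@src Q) (take n (parr p))))
    (drop n (parr p)).
Proof.
by move: (pwordP p); rewrite -[X in composable _ X](cat_take_drop n)
  composable_cat => /andP[].
Qed.

(* p = (ptake n p) (pdrop n p): the first n letters and the remaining ones. *)
Definition ptake n p : qpath Q :=
  @QPath Q (_, _) (ptake_subproof n p).
Definition pdrop n p : qpath Q :=
  @QPath Q (_, _) (pdrop_subproof n p).

Definition cyclic p : bool := (0 < plen p) && (psrc p == ptgt p).

(* a_1 a_2 ... a_n |-> a_2 ... a_n a_1 if the path is closed; all other paths
   are fixed, as then the rotated word is not composable. *)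
Definition protate p : qpath Q :=
  insubd p (ptgt (pdrop 1 p), rot 1 (parr p)).

(* The distinct cyclic shifts of p (only p itself if p is not cyclic). *)
Definition cshifts p : seq (qpath Q) :=
  undup (traject protate p (plen p).+1).

Definition is_chord p (b : qarr Q) (i j : 'I_(size (parr p))) : bool :=
  [&& i != j, tgt b == tgt (tnth (in_tuple (parr p)) i)
            & src b == src (tnth (in_tuple (parr p)) j)].

Definition chordless p : bool :=
  cyclic p && ~~ [exists b, exists i, exists j, @is_chord p b i j].

Lemma plen_take n p : n <= plen p -> plen (ptake n p) = n.
Proof. exact: size_takel. Qed.

Lemma plen_drop n p : plen (pdrop n p) = plen p - n.
Proof. exact: size_drop. Qed.

Lemma ptake_take n l p : l <= n -> ptake l (ptake n p) = ptake l p.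
Proof. by move=> le_ln; apply: val_inj; rewrite /= /parr /= take_takel. Qed.

Lemma pdrop_drop n l p : pdrop l (pdrop n p) = pdrop (n + l) p.
Proof.
apply: val_inj; rewrite /= /parr /ptgt /= drop_drop addnC; congr (_, _).
by rewrite -last_cat -map_cat -takeD addnC.
Qed.

Lemma ptake_drop n l p : ptake l (pdrop n p) = pdrop n (ptake (n + l) p).
Proof.
apply: val_inj; rewrite /= /parr /ptgt /= take_drop take_takel ?leq_addr //.
by rewrite addnC.
Qed.

Lemma ptake_full p : ptake (plen p) p = p.
Proof. by apply: val_inj; rewrite /= take_size; case: p => [[]]. Qed.

Lemma pdrop0 p : pdrop 0 p = p.
Proof. by apply: val_inj; rewrite /= take0 drop0; case: p => [[]]. Qed.

End Paths.

Local Open Scope ring_scope.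

(* Elements of the path algebra completed with respect to path length: an
   arbitrary, possibly infinite, linear combination sum_p (f p) p of paths. *)
Record cpalg (k : fieldType) (Q : quiver) := Cpalg {
  pcoef :> qpath Q -> k }.

HB.instance Definition _ k Q := gen_eqMixin (cpalg k Q).
HB.instance Definition _ k Q := gen_choiceMixin (cpalg k Q).

Section CompletedPathAlgebra.
Variables (k : fieldType) (Q : quiver).
Implicit Types f g h : cpalg k Q.

Lemma cpalg_ext f g : (forall p, f p = g p) -> f = g.
Proof.
by case: f g => [f] [g] /= eq_fg; congr Cpalg; apply: functional_extensionality_dep.
Qed.

Definition cpa_zero : cpalg k Q := Cpalg (fun=> 0).
Definition cpa_opp f : cpalg k Q := Cpalg (fun p => - f p).
Definition cpa_add f g : cpalg k Q := Cpalg (fun p => f p + g p).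
Definition cpa_scale (c : k) f : cpalg k Q := Cpalg (fun p => c * f p).
Definition cpa_one : cpalg k Q := Cpalg (fun p => (plen p == 0)%:R).
Definition cpa_mul f g : cpalg k Q :=
  Cpalg (fun p => \sum_(n < (plen p).+1) f (ptake n p) * g (pdrop n p)).

Fact cpa_addA : associative cpa_add.
Proof. by move=> f g h; apply: cpalg_ext => p /=; rewrite addrA. Qed.
Fact cpa_addC : commutative cpa_add.
Proof. by move=> f g; apply: cpalg_ext => p /=; rewrite addrC. Qed.
Fact cpa_add0 : left_id cpa_zero cpa_add.
Proof. by move=> f; apply: cpalg_ext => p /=; rewrite add0r. Qed.
Fact cpa_addN : left_inverse cpa_zero cpa_opp cpa_add.
Proof. by move=> f; apply: cpalg_ext => p /=; rewrite addNr. Qed.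

HB.instance Definition _ :=
  GRing.isZmodule.Build (cpalg k Q) cpa_addA cpa_addC cpa_add0 cpa_addN.

Fact cpa_mulA : associative cpa_mul.
Proof.
move=> f g h; apply: cpalg_ext => p /=.
pose F l n := f (ptake l p) * g (pdrop l (ptake n p)) * h (pdrop n p).
transitivity
    (\sum_(l < (plen p).+1) \sum_(n < (plen p).+1 | (l <= n)%N) F l n).
  apply: eq_bigr => l _; rewrite mulr_sumr plen_drop.
  have le_lp : (l <= (plen p).+1)%N by rewrite ltnW.
  rewrite -(big_geq_mkord _ _ xpredT (F l)) -[nat_of_ord l]add0n big_addn add0n.
  rewrite subSn -1?ltnS // big_mkord.
  apply: eq_bigr => n _.
  by rewrite /F mulrA pdrop_drop ptake_drop addnC.
rewrite (exchange_big_dep predT) //=; apply: eq_bigr => n _.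
rewrite mulr_suml plen_take -1?ltnS //.
rewrite (big_ord_widen_cond (plen p).+1 predT
  (fun l => f (ptake l (ptake n p)) * g (pdrop l (ptake n p)) * h (pdrop n p)))
  //=.
by apply: eq_big => [l|l le_ln]; rewrite ?ltnS // /F ptake_take.
Qed.

Fact cpa_mul1 : left_id cpa_one cpa_mul.
Proof.
move=> f; apply: cpalg_ext => p /=; rewrite big_ord_recl /= big1 ?addr0.
  by rewrite pdrop0 plen_take // mul1r.
by move=> n _; rewrite plen_take // mul0r.
Qed.

Fact cpa_mulr1 : right_id cpa_one cpa_mul.
Proof.
move=> f; apply: cpalg_ext => p /=; rewrite big_ord_recr /= big1 ?add0r.
  by rewrite ptake_full plen_drop subnn mulr1.
by move=> n _; rewrite plen_drop subn_eq0 leqNgt ltn_ord mulr0.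
Qed.

Fact cpa_mulDl : left_distributive cpa_mul cpa_add.
Proof.
move=> f g h; apply: cpalg_ext => p /=; rewrite -big_split /=.
by apply: eq_bigr => n _; rewrite mulrDl.
Qed.

Fact cpa_mulDr : right_distributive cpa_mul cpa_add.
Proof.
move=> f g h; apply: cpalg_ext => p /=; rewrite -big_split /=.
by apply: eq_bigr => n _; rewrite mulrDr.
Qed.

HB.instance Definition _ := GRing.Zmodule_isPzRing.Build (cpalg k Q)
  cpa_mulA cpa_mul1 cpa_mulr1 cpa_mulDl cpa_mulDr.

Fact cpa_scaleA a b f : cpa_scale a (cpa_scale b f) = cpa_scale (a * b) f.
Proof. by apply: cpalg_ext => p /=; rewrite mulrA. Qed.
Fact cpa_scale1 : left_id 1 cpa_scale.
Proof. by move=> f; apply: cpalg_ext => p /=; rewrite mul1r. Qed.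
Fact cpa_scaleDr : right_distributive cpa_scale +%R.
Proof. by move=> a f g; apply: cpalg_ext => p /=; rewrite mulrDr. Qed.
Fact cpa_scaleDl f : {morph cpa_scale^~ f : a b / a + b}.
Proof. by move=> a b; apply: cpalg_ext => p /=; rewrite mulrDl. Qed.

HB.instance Definition _ := GRing.Zmodule_isLmodule.Build k (cpalg k Q)
  cpa_scaleA cpa_scale1 cpa_scaleDr cpa_scaleDl.

Definition idem (i : qvert Q) : cpalg k Q :=
  Cpalg (fun p => (p == lazy i)%:R).

Implicit Types W P : cpalg k Q.

Definition is_potential W : Prop := forall p, W p != 0 -> cyclic p.

(* The coefficient of W at the class of p up to cyclic shift. *)
Definition ccoef W (p : qpath Q) : k := \sum_(q <- cshifts p) W q.

(* W and W' define the same potential up to cyclic shift: W - W' lies in the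
   closure of the span of the a_1 a_2 ... a_n - a_2 ... a_n a_1, where
   a_1 ... a_n runs over the cyclic paths. Classes up to shift being finite,
   this means that the sums of coefficients over each class agree. *)
Definition cyc_equiv W W' : Prop := forall p, ccoef W p = ccoef W' p.

(* Automorphisms of the k-algebra R<<Q>> which are the identity on the span R
   of the idempotents e_i. They are automatically continuous, because they
   preserve the Jacobson radical, which is the closed span of the paths of
   positive length. *)
Definition right_equivalence (phi : {rmorphism cpalg k Q -> cpalg k Q}) :
  Prop :=
  [/\ bijective phi, scalable phi & forall i, phi (idem i) = idem i].

Definition right_equivalent W W' : Prop :=
  exists2 phi : {rmorphism cpalg k Q -> cpalg k Q},
    right_equivalence phi & cyc_equiv (phi W) W'.

Definition primitive P : Prop :=
  is_potential P /\
  forall p, cyclic p -> (ccoef P p != 0) = chordless p.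

Definition prim_part W : cpalg k Q :=
  Cpalg (fun p => if chordless p then W p else 0).

Definition generic W : Prop := is_potential W /\ primitive (prim_part W).

(* P and P' are in the same orbit of the group of the right-equivalences that
   map the space of primitive potentials onto itself. *)
Definition same_primitive_class P P' : Prop :=
  exists2 phi : {rmorphism cpalg k Q -> cpalg k Q},
    right_equivalence phi /\ (forall P0, primitive P0 <-> primitive (phi P0))
    & cyc_equiv (phi P) P'.

End CompletedPathAlgebra.

Local Close Scope ring_scope.

(* A closed oriented surface glued from oriented triangles. The corners of
   each triangle t are numbered 0, 1, 2 counterclockwise, and (t, i) stands
   both for the corner i of t and for the side of t running from the corner i
   to the corner i + 1 (mod 3). The side s is glued to the side [glue s], in
   the orientation-reversing way, so that the surface is oriented. *)
Record gluing := Gluing {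
  tri : finType;
  glue : tri * 'I_3 -> tri * 'I_3;
  glueK : involutive glue;
  glue_neq : forall s, glue s != s }.

(* The side (t, i) starts at the corner i; if it is glued to (t', i'), that
   corner coincides with the corner i' + 1 of t'. Iterating this turns once
   around the marked point at (t, i). *)
Definition next_corner (G : gluing) (c : tri G * 'I_3) : tri G * 'I_3 :=
  ((glue c).1, ordS (glue c).2).

Definition same_marked_point (G : gluing) : rel (tri G * 'I_3) :=
  fconnect (@next_corner G).

(* Number of arc ends at the marked point at c: each arc end is the start of
   exactly one oriented side. *)
Definition valence (G : gluing) (c : tri G * 'I_3) : nat :=
  order (@next_corner G) c.

Definition num_marked_points (G : gluing) : nat :=
  fcard (@next_corner G) predT.

Definition num_arcs (G : gluing) : nat := fcard (@glue G) predT.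

Definition connected_gluing (G : gluing) : Prop :=
  forall t t' : tri G,
    connect (fun t1 t2 => [exists i, (glue (t1, i)).1 == t2]) t t'.

(* G is an ideal triangulation of the connected closed surface of genus g with
   d marked points. The genus is read off from the Euler characteristic:
   V - E + F = 2 - 2g, with V = d. *)
Definition ideal_triangulation (g d : nat) (G : gluing) : Prop :=
  [/\ connected_gluing G,
      num_marked_points G = d
    & (d%:Z - (num_arcs G)%:Z + #|tri G|%:Z = 2 - 2 * g%:Z)%R].

(* The arc carried by the side (t, i) joins the corners i and i + 1 of t. *)
Definition no_loop_arc (G : gluing) : Prop :=
  forall (t : tri G) (i : 'I_3), ~~ same_marked_point (t, i) (t, ordS i).

(* Integral points of the triangle x + y + z = m + 1 other than its corners. *)
Definition lattice_point (m : nat) :=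
  {p : {ffun 'I_3 -> 'I_m.+2} |
    (\sum_i p i == m.+1) && [forall i, p i != m.+1 :> nat]}.

(* Triples (a, b, c) with a + b + c = m - 1, indexing the black triangles. *)
Definition black_triangle (m : nat) :=
  {a : {ffun 'I_3 -> 'I_m} | \sum_i a i == m.-1}.

(* The vertex of the black triangle obtained from (a, b, c) by adding 1 to the
   coordinates other than the j-th; 0 -> 1 -> 2 -> 0 is counterclockwise. *)
Definition black_vertex_fun (m : nat) (a : black_triangle m) (j : 'I_3) :
  {ffun 'I_3 -> 'I_m.+2} := [ffun i => inord (val a i + (i != j))].

Lemma black_vertex_funE m (a : black_triangle m) j i :
  black_vertex_fun a j i = val a i + (i != j) :> nat.
Proof.
rewrite ffunE inordK //; case: (val a i) => n /= lt_nm.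
apply: (@leq_trans n.+2); last by rewrite !ltnS ltnW.
by case: (i != j); rewrite ?addn0 ?addn1.
Qed.

Fact black_vertex_subproof m (a : black_triangle m) j :
  (\sum_i black_vertex_fun a j i == m.+1) &&
  [forall i, black_vertex_fun a j i != m.+1 :> nat].
Proof.
apply/andP; split; last first.
  apply/forallP => i; rewrite black_vertex_funE neq_ltn.
  case: (val a i) => n /= lt_nm.
  by rewrite ltnS; case: (i != j); rewrite ?addn0 ?addn1 ?(ltnW lt_nm) ?lt_nm.
rewrite (eq_bigr _ (fun i _ => black_vertex_funE a j i)) big_split /=.
rewrite (eqP (valP a)) -big_mkcond sum1_card cardC1 card_ord /=.
by case: m a => [[f _]|m _]; [case: (f ord0) | rewrite addn2].
Qed.

Definition black_vertex (m : nat) (a : black_triangle m) (j : 'I_3) :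
  lattice_point m := exist _ (black_vertex_fun a j) (black_vertex_subproof a j).

(* Lattice points in the disjoint union of copies of the standard triangle;
   the i-th coordinate of (t, p) is the one equal to m + 1 at the corner i. *)
Definition point (G : gluing) (m : nat) : finType :=
  (tri G * lattice_point m)%type.

Definition coord (G : gluing) (m : nat) (x : point G m) (i : 'I_3) : nat :=
  val x.2 i.

(* x lies on a side (t, i), i.e. its coordinate at the opposite corner i - 1
   vanishes, y lies on the side (t', j) glued to it, and x and y match when
   the corners i, i + 1 of t are identified with the corners j + 1, j of t'. *)
Definition glued (G : gluing) (m : nat) : rel (point G m) := fun x y =>
  [exists i, exists j,
    [&& glue (x.1, i) == (y.1, j),
        coord x (ord_pred i) == 0, coord y (ord_pred j) == 0,
        coord y (ordS j) == coord x i & coord y j == coord x (ordS i)]].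

Definition glued_classes (G : gluing) (m : nat) : {set {set point G m}} :=
  equivalence_partition (connect (@glued G m)) [set: point G m].

Definition tri_vertex (G : gluing) (m : nat) : finType :=
  {C : {set point G m} | C \in glued_classes G m}.

Fact vertex_of_subproof (G : gluing) (m : nat) (x : point G m) :
  [set y in [set: point G m] | connect (@glued G m) x y] \in glued_classes G m.
Proof. exact: imset_f. Qed.

Definition vertex_of (G : gluing) (m : nat) (x : point G m) : tri_vertex G m :=
  exist (fun C => C \in glued_classes G m) _ (vertex_of_subproof x).

(* The arrow (t, a, j) is the edge of the black triangle a of t from its
   vertex j to its vertex j + 1, which is its counterclockwise orientation. *)
Definition tri_arrow (G : gluing) (m : nat) : finType :=
  (tri G * black_triangle m * 'I_3)%type.

Definition tri_quiver (G : gluing) (m : nat) : quiver :=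
  @Quiver (tri_vertex G m) (tri_arrow G m)
    (fun e => vertex_of (e.1.1, black_vertex e.1.2 e.2))
    (fun e => vertex_of (e.1.1, black_vertex e.1.2 (ordS e.2))).

(* Main.v *)
From HB Require Import structures.
Require Import Defs.
From mathcomp Require Import all_boot all_order all_algebra.

Set Implicit Arguments.
Unset Strict Implicit.
Unset Printing Implicit Defensive.

Import GRing.Theory.

(** A right-equivalence phi replaces each letter a of a cycle by a linear
    combination of paths parallel to a, i.e. with the same endpoints. If some
    letter is replaced by a path of length at least 2, then a is an arrow from
    the source of the last letter of that path to the target of its first
    letter: the resulting cycle has a chord. Hence the coefficients of phi(W)
    at chordless cycles only depend on the diagonal part of phi, which sends
    arrows to combinations of parallel arrows.

    In the quiver of a triangulation no two arrows are parallel
    ([tri_quiver_thin]), so the diagonal part multiplies each arrow a by a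
    scalar c_a. Then phi(W) and W differ at every chordless path by the product
    of the c_a over its letters ([right_equivalence_no_shortcut]); applied to
    paths of length 1 this also gives c_a != 0, as phi is surjective. The
    automorphism [rescale] which multiplies each arrow a by c_a is therefore a
    right-equivalence, it sends the primitive part of W to that of phi(W), and
    it preserves primitivity, since it multiplies the coefficient at each
    cyclic class by a nonzero scalar.

    That phi sends an arrow to an element without constant term is the
    invariance of the Jacobson radical: 1 - f is invertible whenever f has no
    constant term, by the geometric series, whereas an element with a vanishing
    coefficient at some e_i is never invertible.

    The absence of parallel arrows is where the triangulation enters. Points
    are glued in pairs across arcs, and an arrow never joins two points of the
    same side, so two parallel arrows would force either a triangle with two
    sides glued together, hence an arc with coinciding endpoints, or two
    triangles sharing two sides; in the latter case either an arc has
    coinciding endpoints or the common corner has valence 2. *)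

(** * Chords and cyclic shifts *)

Local Open Scope ring_scope.

Section Paths.
Variable Q : quiver.
Implicit Types (p q : qpath Q) (a b : qarr Q).

Fact arrow_subproof a : composable (tgt a) [:: a].
Proof. by rewrite /= eqxx. Qed.

Definition arrow a : qpath Q := @QPath Q (_, _) (arrow_subproof a).

Lemma qpathP p q : ptgt p = ptgt q -> parr p = parr q -> p = q.
Proof.
move=> e1 e2; apply: val_inj; rewrite [LHS]surjective_pairing.
by rewrite [RHS]surjective_pairing; congr (_, _).
Qed.

Lemma plen0 p : plen p = 0%N -> p = lazy (ptgt p).
Proof. by move=> /size0nil e; apply: qpathP. Qed.

Lemma qpath_cons p a w : parr p = a :: w ->
  [/\ ptgt p = tgt a, ptake 1 p = arrow a, ptgt (pdrop 1 p) = src a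
    & parr (pdrop 1 p) = w].
Proof.
case: p => -[i v] pP; rewrite /parr /= => e; subst v.
have /andP[/eqP ti _] := pP; rewrite /= in ti.
split; rewrite ?/ptgt ?/parr /= ?drop0 ?take0 ?ti //.
by apply: qpathP; rewrite /ptgt /parr /= ?take0.
Qed.

(** When b precedes c in a path, an arrow refuting this relation is parallel to
    the subpath from b to c. This one-sided condition passes to the tail of a
    path, unlike [chordless]. *)
Definition no_shortcut : rel (qarr Q) := fun b c =>
  ~~ [exists a, (tgt a == tgt b) && (src a == src c)].

Definition no_chord : rel (qarr Q) := fun b c =>
  no_shortcut b c && no_shortcut c b.

(** A chord needs two positions i != j in either order, so that chordlessness
    is a symmetric condition on pairs of letters, and thus invariant under
    rotation. *)
Lemma chordlessE p : chordless p = cyclic p && pairwise no_chord (parr p).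
Proof.
rewrite /chordless; congr (_ && _); apply/idP/idP.
  move=> nc; have [s0|[a _]] : parr p = [::] \/ exists a, a \in parr p.
    by case: (parr p) => [|a s]; [left | right; exists a; rewrite mem_head].
    by rewrite s0.
  have noij (i j : 'I_(size (parr p))) : i != j ->
      no_shortcut (nth a (parr p) i) (nth a (parr p) j).
    move=> ij; apply: contra nc => /existsP[b bP].
    apply/existsP; exists b; apply/existsP; exists i; apply/existsP; exists j.
    by rewrite /is_chord ij !(tnth_nth a).
  apply/(pairwiseP a) => i j; rewrite !inE => hi hj ij.
  have ne : Ordinal hi != Ordinal hj by rewrite -val_eqE /= ltn_eqF.
  by rewrite /no_chord (noij _ _ ne) (noij (Ordinal hj) (Ordinal hi)) // eq_sym.
move=> pw; apply/existsP=> -[b /existsP[i /existsP[j /and3P[ij tb sb]]]].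
have nsij : no_chord (nth b (parr p) i) (nth b (parr p) j).
  move: ij; rewrite -val_eqE neq_ltn => /orP[] ij.
    by apply: (pairwiseP b pw); rewrite ?inE ?ltn_ord.
  by rewrite /no_chord andbC; apply: (pairwiseP b pw); rewrite ?inE ?ltn_ord.
have/andP[/negP + _] := nsij; apply; apply/existsP; exists b.
by move: tb sb; rewrite !(tnth_nth b) /= => -> ->.
Qed.

Lemma chordless_no_shortcut p : chordless p -> pairwise no_shortcut (parr p).
Proof.
by rewrite chordlessE => /andP[_]; apply: sub_pairwise => a b /andP[].
Qed.

(** The rotated word of a path that is not closed is not composable, so that
    [protate] falls back on its default value. *)
Lemma protate_cases p : protate p = p \/
  [/\ parr (protate p) = rot 1 (parr p), cyclic p & cyclic (protate p)].
Proof.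
rewrite /protate /insubd; case: insubP => [q _ qE|]; last by left.
have : parr q = rot 1 (parr p) by rewrite /parr qE.
have : ptgt q = ptgt (pdrop 1 p) by rewrite /ptgt qE.
case ep: (parr p) => [|a w] tq aq.
  left; apply: qpathP; last by rewrite aq.
  by rewrite tq /ptgt /= ep.
have [tp _ tdp _] := qpath_cons ep.
have := pwordP q; rewrite -/(ptgt q) -/(parr q) aq rot1_cons tq tdp.
rewrite -cats1 composable_cat /= andbT => /andP[_ /eqP e].
right; split=> //; rewrite /cyclic /plen /psrc ?ep ?aq ?tp /=.
  by rewrite e eqxx.
by rewrite rot1_cons size_rcons map_rcons last_rcons tq tdp eqxx.
Qed.

Lemma chordless_protate p : chordless (protate p) = chordless p.
Proof.
have [-> //|[e c c']] := protate_cases p; rewrite !chordlessE c c' e /=.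
case: (parr p) => // a w; rewrite rot1_cons -cats1 pairwise_cat /= allrel1r.
rewrite !andbT; congr (_ && _); apply: eq_all => b.
by rewrite /no_chord andbC.
Qed.

Lemma perm_protate p : perm_eq (parr (protate p)) (parr p).
Proof. by have [-> //|[-> _ _]] := protate_cases p; rewrite perm_rot. Qed.

Lemma cshifts_ind (P : qpath Q -> Prop) p :
  P p -> (forall q, P q -> P (protate q)) -> forall q, q \in cshifts p -> P q.
Proof.
move=> Pp Pr q; rewrite mem_undup => /trajectP[n _ ->].
by elim: n => //= n; apply: Pr.
Qed.

Lemma chordless_cshifts p q : q \in cshifts p -> chordless q = chordless p.
Proof.
by apply: (@cshifts_ind (fun q => _ = _)) => // r <-; exact: chordless_protate.
Qed.

Lemma perm_cshifts p q : q \in cshifts p -> perm_eq (parr q) (parr p).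
Proof.
apply: (@cshifts_ind (fun q => perm_eq _ _)) => // r.
by apply: perm_trans; exact: perm_protate.
Qed.

End Paths.

(** * The completed path algebra *)

Section Algebra.
Variables (k : fieldType) (Q : quiver).
Implicit Types (f g h : cpalg k Q) (p q : qpath Q) (a b : qarr Q).

Definition arrow_elt a : cpalg k Q := Cpalg (fun p => (p == arrow a)%:R).

(** The n-th power of the closed ideal generated by the arrows. *)
Definition in_rad (n : nat) f := forall p, (plen p < n)%N -> f p = 0.

Lemma cpalg_addE f g p : (f + g) p = f p + g p. Proof. by []. Qed.
Lemma cpalg_oppE f p : (- f) p = - f p. Proof. by []. Qed.
Lemma cpalg_scaleE c f p : (c *: f) p = c * f p. Proof. by []. Qed.
Lemma cpalg_mulE f g p :
  (f * g) p = \sum_(n < (plen p).+1) f (ptake n p) * g (pdrop n p).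
Proof. by []. Qed.
Lemma cpalg_oneE p : (1 : cpalg k Q) p = (plen p == 0%N)%:R.
Proof. by []. Qed.
Lemma cpalg_sumE (I : Type) (r : seq I) (P : pred I) (F : I -> cpalg k Q) p :
  (\sum_(i <- r | P i) F i) p = \sum_(i <- r | P i) F i p.
Proof. by elim/big_ind2: _ => // f x g y <- <-. Qed.

Lemma mul_lazy f g i : (f * g) (lazy i) = f (lazy i) * g (lazy i).
Proof.
by rewrite cpalg_mulE big_ord1; congr (f _ * g _); apply: qpathP.
Qed.

Lemma mul_eq_plen h f g p :
  (forall q, (plen q <= plen p)%N -> f q = g q) -> (h * f) p = (h * g) p.
Proof.
move=> e; rewrite !cpalg_mulE; apply: eq_bigr => n _; rewrite e //.
by rewrite plen_drop leq_subr.
Qed.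

Lemma in_rad_exp f n : in_rad 1 f -> in_rad n (f ^+ n).
Proof.
move=> fr; elim: n => [//|n IHn] p lp; rewrite exprS cpalg_mulE big1 // => i _.
case: (posnP i) => [-> |i0]; first by rewrite fr ?mul0r // plen_take.
rewrite IHn ?mulr0 // plen_drop ltn_subLR; last by rewrite -ltnS.
by rewrite (leq_trans lp) // -add1n leq_add2r.
Qed.

(** The inverse is the geometric series; its coefficient at p is a finite sum,
    since f ^+ n vanishes on paths shorter than n. *)
Lemma one_sub_inv f : in_rad 1 f -> exists g, (1 - f) * g = 1.
Proof.
move=> fr; pose S N := \sum_(n < N) f ^+ n.
have SE N p : (plen p < N)%N -> S N p = S (plen p).+1 p.
  move=> lp; rewrite -(subnKC lp); elim: (N - _)%N => [|d IHd].
    by rewrite addn0.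
  rewrite addnS {1}/S big_ord_recr cpalg_addE [X in X + _]IHd.
  by rewrite (in_rad_exp fr) ?addr0 // leq_addr.
exists (Cpalg (fun p => S (plen p).+1 p)); apply: cpalg_ext => p.
rewrite (@mul_eq_plen _ _ (S (plen p).+1)) => [|q lq]; last by rewrite [RHS]SE.
have -> : (1 - f) * S (plen p).+1 = 1 - f ^+ (plen p).+1.
  by rewrite -opprB mulNr -subrX1 opprB.
by rewrite cpalg_addE cpalg_oppE (in_rad_exp fr) ?oppr0 ?addr0.
Qed.

(** The f_a with f = sum_a a f_a up to constant terms: the coefficient of f_a at
    p is that of f at ap. When ap is not a path, any default value gives the
    same product of a with f_a. *)
Definition left_quotient a f : cpalg k Q :=
  Cpalg (fun p => f (insubd (lazy (tgt a)) (tgt a, a :: parr p))).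

Lemma left_quotientE p a w f :
  parr p = a :: w -> left_quotient a f (pdrop 1 p) = f p.
Proof.
move=> e; have [tp _ tdp adp] := qpath_cons e; rewrite /= adp.
congr (f _); apply: val_inj.
have -> : (tgt a, a :: w) = val p by rewrite -tp -e -surjective_pairing.
by rewrite valKd.
Qed.

Lemma mul_arrow_lazy a f i : (arrow_elt a * f) (lazy i) = 0.
Proof.
by rewrite mul_lazy /=; case: eqP => [/(congr1 (@plen Q)) //|_]; rewrite mul0r.
Qed.

Lemma mul_arrow_cons a f p b w : parr p = b :: w ->
  (arrow_elt a * f) p = (b == a)%:R * f (pdrop 1 p).
Proof.
move=> e; have [_ tkp _ _] := qpath_cons e.
have lp : (0 < plen p)%N by rewrite /plen e.
rewrite cpalg_mulE (bigD1 (Ordinal (lp : (1 < (plen p).+1)%N))) //= tkp.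
rewrite big1 ?addr0 => [|n n1]; last first.
  case: eqP => [en|]; rewrite ?mul0r //; case/eqP: n1; apply: val_inj => /=.
  by rewrite -[LHS](@plen_take _ _ p) -1?ltnS // en.
congr ((nat_of_bool _)%:R * _).
by apply/idP/idP => [/eqP/(congr1 (@parr Q)) [->]|/eqP ->].
Qed.

(** A finite sum of products, hence preserved by every ring morphism: this is
    what replaces continuity in evaluating an automorphism on infinite sums. *)
Lemma cpalg_decomp f :
  f = \sum_i f (lazy i) *: idem k i + \sum_a arrow_elt a * left_quotient a f.
Proof.
apply: cpalg_ext => p; rewrite cpalg_addE !cpalg_sumE.
case e: (parr p) => [|b w].
  rewrite [p]plen0 /plen ?e //; set i := ptgt p.
  rewrite [X in _ + X]big1 => [|a _]; last exact: mul_arrow_lazy.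
  rewrite (bigD1 i) //= eqxx mulr1 big1 ?addr0 // => j /negPf ji.
  by rewrite /=; case: eqP => [[/eqP]|_]; rewrite ?mulr0 // eq_sym ji.
rewrite big1 ?add0r => [|i _]; last first.
  by rewrite /=; case: eqP => [ep|]; rewrite ?mulr0 //; rewrite ep in e.
rewrite (bigD1 b) // (mul_arrow_cons _ _ e) eqxx mul1r (left_quotientE _ e).
rewrite big1 => [|a /negPf ab]; first exact/esym/addr0.
by rewrite (mul_arrow_cons _ _ e) eq_sym ab mul0r.
Qed.

Lemma idem_mull i f p : (idem k i * f) p = (ptgt p == i)%:R * f p.
Proof.
rewrite cpalg_mulE big_ord_recl /= big1 ?addr0 => [|n _].
  rewrite pdrop0; congr ((nat_of_bool _)%:R * _).
  apply/idP/idP => [/eqP/(congr1 (@ptgt Q)) e|/eqP <-].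
    exact/eqP.
  by apply/eqP/qpathP; rewrite // /parr /= take0.
by case: eqP => [/(congr1 (@plen Q))|]; rewrite ?mul0r // plen_take.
Qed.

Lemma idem_mulr i f p : (f * idem k i) p = (psrc p == i)%:R * f p.
Proof.
rewrite cpalg_mulE big_ord_recr /= big1 ?add0r => [|n _].
  rewrite ptake_full mulrC; congr ((nat_of_bool _)%:R * _).
  have e : pdrop (plen p) p = lazy (psrc p).
    by apply: qpathP; rewrite /ptgt /parr /= ?drop_size // take_size.
  rewrite e; apply/idP/idP => [/eqP/(congr1 (@ptgt Q)) ei|/eqP <- //].
  exact/eqP.
case: eqP => [/(congr1 (@plen Q))|]; rewrite ?mulr0 // plen_drop /plen /=.
by move=> /eqP; rewrite subn_eq0 leqNgt ltn_ord.
Qed.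

Lemma arrow_elt_idem a :
  arrow_elt a = idem k (tgt a) * arrow_elt a * idem k (src a).
Proof.
apply: cpalg_ext => p; rewrite idem_mulr idem_mull /=.
by case: (eqVneq p (arrow a)) => [->|_]; rewrite ?mulr0 // !eqxx !mul1r.
Qed.

(** * Right-equivalences on paths without chords *)

Section RightEquivalence.
Variable phi : {rmorphism cpalg k Q -> cpalg k Q}.
Hypothesis phiP : right_equivalence phi.

(** If phi(f) had the coefficient c != 0 at e_i, the invertible 1 - f/c would be
    mapped to an element whose coefficient at e_i vanishes. *)
Lemma right_equivalence_rad f : in_rad 1 f -> in_rad 1 (phi f).
Proof.
move=> fr p; rewrite ltnS leqn0 => /eqP/plen0 ->; set i := ptgt p.
have [_ phiZ _] := phiP.
apply/eqP/negPn/negP => c0; set c := phi f (lazy i) in c0.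
have [|g /(congr1 phi)] := @one_sub_inv (c^-1 *: f).
  by move=> q lq; rewrite cpalg_scaleE fr ?mulr0.
rewrite rmorphM rmorphB rmorph1 phiZ.
move=> /(congr1 (fun h : cpalg k Q => h (lazy i))).
rewrite mul_lazy cpalg_addE cpalg_oppE cpalg_scaleE cpalg_oneE /=.
by rewrite -/c mulVf // subrr mul0r => /esym/eqP; rewrite oner_eq0.
Qed.

(** Since a = e_(t(a)) a e_(s(a)) and the idempotents are fixed, only paths
    parallel to a occur in phi(a). *)
Lemma right_equivalence_arrow a p : phi (arrow_elt a) p != 0 ->
  [/\ (0 < plen p)%N, ptgt p = tgt a & psrc p = src a].
Proof.
have [_ _ phi1] := phiP.
have arad : in_rad 1 (arrow_elt a).
  move=> q /=; rewrite ltnS leqn0 => /eqP lq.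
  by case: eqP => // eq; rewrite eq in lq.
case: (posnP (plen p)) => [lp|lp].
  by rewrite (right_equivalence_rad arad) ?eqxx // lp.
rewrite arrow_elt_idem !rmorphM !phi1 idem_mulr idem_mull.
by case: (psrc p =P _) => [->|_]; case: (ptgt p =P _) => [->|_];
  rewrite ?mul0r ?mulr0 ?mul0r ?eqxx.
Qed.

Definition diag_coef a : k := phi (arrow_elt a) (arrow a).

Definition weight (l : qarr Q -> k) p : k := \prod_(a <- parr p) l a.

Hypothesis thin : injective (fun a : qarr Q => (src a, tgt a)).

(** Write p = b p'. In phi(f) = sum_a phi(a) phi(f_a), a prefix of p of length
    at least 2 cannot occur in phi(a), as a would be a shortcut; so phi(a) only
    contributes through the prefix b, for a = b by thinness, and the claim
    follows from the case of f_b and p'. *)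
Lemma right_equivalence_no_shortcut f p :
  pairwise (@no_shortcut Q) (parr p) -> phi f p = weight diag_coef p * f p.
Proof.
have [_ phiZ phi1] := phiP.
have [n] := ubnP (plen p); elim: n p f => // n IHn p f lp nsp.
rewrite [in LHS](cpalg_decomp f) rmorphD !rmorph_sum cpalg_addE !cpalg_sumE.
under eq_bigr => i _ do rewrite phiZ phi1 cpalg_scaleE.
under [X in _ + X]eq_bigr => a _ do rewrite rmorphM cpalg_mulE.
case e: (parr p) => [|b w].
  rewrite [p]plen0 /plen ?e //; set i := ptgt p.
  rewrite /weight big_nil mul1r.
  rewrite [X in _ + X]big1 ?addr0 => [|a _]; last first.
    rewrite big_ord1; case: (eqVneq (phi (arrow_elt a) (ptake 0 (lazy i))) 0).
      by move=> ->; rewrite mul0r.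
    by case/right_equivalence_arrow.
  rewrite (bigD1 i) //= eqxx mulr1 big1 ?addr0 // => j /negPf ji.
  by case: eqP => [[/eqP]|_]; rewrite ?mulr0 // eq_sym ji.
have [tp tkp tdp adp] := qpath_cons e.
have lp0 : (0 < plen p)%N by rewrite /plen e.
rewrite big1 ?add0r => [|i _]; last first.
  by rewrite /=; case: eqP => [ep|]; rewrite ?mulr0 //; rewrite ep in e.
have [/allP nsb nsw] : all (no_shortcut b) w /\ pairwise (@no_shortcut Q) w.
  by move: nsp; rewrite e => /andP.
have off a (i : 'I_(plen p).+1) : i != 1%N :> nat ->
    phi (arrow_elt a) (ptake i p) = 0.
  move=> i1; apply/eqP; apply: contraT => /right_equivalence_arrow[].
  rewrite plen_take -1?ltnS // {1}/ptgt /= -/(ptgt p) tp => i0 tb.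
  (* now i >= 2, and the last letter of the prefix is a letter of w *)
  case: i i1 i0 => [[|[|i]] //= ip] _ _.
  rewrite /psrc /ptgt /parr /= e /= => sa.
  have : last (src b) (map (@src Q) (take i.+1 w)) \in map (@src Q) w.
    case: w e adp nsb nsw sa => [|c w] e _ _ _ _.
      by move: ip; rewrite ltnS /plen e.
    have /= := mem_last (src c) (take i (map (@src Q) w)).
    by rewrite map_take !in_cons => /orP[->//|/mem_take->]; rewrite orbT.
  rewrite sa => /mapP[c cw sc].
  by have := nsb c cw; case/existsP; exists a; rewrite -tb sc !eqxx.
have le1 : (1 < (plen p).+1)%N by [].
transitivity (\sum_a phi (arrow_elt a) (arrow b) *
                      phi (left_quotient a f) (pdrop 1 p)).
  apply: eq_bigr => a _; rewrite (bigD1 (Ordinal le1)) //= tkp.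
  rewrite big1 ?addr0 // => i i1.
  by rewrite off ?mul0r.
rewrite (bigD1 b) //= big1 ?addr0 => [|a ab]; last first.
  case: (eqVneq (phi (arrow_elt a) (arrow b)) 0) => [->|].
    by rewrite mul0r.
  case/right_equivalence_arrow => _ tb sb; case/eqP: ab; apply: thin.
  by congr (_, _).
rewrite (IHn (pdrop 1 p)) ?adp //; last by move: lp; rewrite /plen adp e.
by rewrite (left_quotientE _ e) mulrA /weight e adp big_cons.
Qed.

(** Test the previous lemma at the path a, on a preimage of the arrow a. *)
Lemma diag_coef_neq0 a : diag_coef a != 0.
Proof.
have [[psi _ phiK] _ _] := phiP.
have := @right_equivalence_no_shortcut (psi (arrow_elt a)) (arrow a) isT.
rewrite phiK /= eqxx /weight big_seq1.
by apply: contra_eqN => /eqP->; rewrite mul0r oner_eq0.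
Qed.

End RightEquivalence.

(** The formula in coordinates for the substitution a |-> l(a) a; it is an
    automorphism fixing the idempotents when all the l(a) are nonzero. *)
Definition rescale (l : qarr Q -> k) f : cpalg k Q :=
  Cpalg (fun p => weight l p * f p).

Section Rescale.
Variable l : qarr Q -> k.

Fact rescale_is_zmod_morphism : zmod_morphism (rescale l).
Proof. by move=> f g; apply: cpalg_ext => p /=; rewrite mulrDr mulrN. Qed.

Fact rescale_is_monoid_morphism : monoid_morphism (rescale l).
Proof.
split=> [|f g]; apply: cpalg_ext => p.
  rewrite /=; case: (plen p =P 0%N) => [/size0nil e|_]; last by rewrite mulr0.
  by rewrite /weight e big_nil mulr1.
rewrite /= mulr_sumr; apply: eq_bigr => n _.
rewrite mulrACA; congr (_ * _).
by rewrite /weight /parr /= -big_cat cat_take_drop.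
Qed.

HB.instance Definition _ := GRing.isZmodMorphism.Build _ _ (rescale l)
  rescale_is_zmod_morphism.
HB.instance Definition _ := GRing.isMonoidMorphism.Build _ _ (rescale l)
  rescale_is_monoid_morphism.

End Rescale.

Lemma weight_neq0 l p : (forall a, l a != 0) -> weight l p != 0.
Proof.
move=> l0; apply: (big_ind (fun c => c != 0)) => // [|x y].
  exact: oner_neq0.
exact: mulf_neq0.
Qed.

Lemma ccoef_rescale l f p : ccoef (rescale l f) p = weight l p * ccoef f p.
Proof.
rewrite /ccoef mulr_sumr !big_seq; apply: eq_bigr => q qp /=.
by congr (_ * _); apply: perm_big; exact: perm_cshifts.
Qed.

Lemma rescale_right_equivalence l : (forall a, l a != 0) ->
  right_equivalence (rescale l).
Proof.
move=> l0; split.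
- exists (rescale (fun a => (l a)^-1)) => f; apply: cpalg_ext => p /=;
    rewrite mulrA -big_split /= big1 ?mul1r // => a _.
    by rewrite mulVf.
  by rewrite mulfV.
- by move=> c f; apply: cpalg_ext => p /=; rewrite mulrCA.
move=> i; apply: cpalg_ext => p /=.
by case: eqP => [->|_]; rewrite ?mulr0 // /weight big_nil mulr1.
Qed.

Lemma rescale_primitive l f : (forall a, l a != 0) ->
  primitive (rescale l f) <-> primitive f.
Proof.
move=> l0; have w0 p : (weight l p == 0) = false by apply/negbTE/weight_neq0.
have e g p : (weight l p * g p == 0) = (g p == 0) by rewrite mulf_eq0 w0.
split=> -[fp fc]; split=> p.
- by move=> fp0; apply: fp; rewrite /= e.
- by move=> /fc <-; rewrite ccoef_rescale mulf_eq0 w0.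
- by rewrite /= e; apply: fp.
by move=> /fc <-; rewrite ccoef_rescale mulf_eq0 w0.
Qed.

(** On a cyclic class of chordless cycles, the rescaled primitive part of W
    agrees with phi W; at every other class both primitive parts vanish. *)
Lemma prim_part_right_equivalent (W W' : cpalg k Q) :
  injective (fun a : qarr Q => (src a, tgt a)) -> right_equivalent W W' ->
  right_equivalent (prim_part W) (prim_part W') /\
  same_primitive_class (prim_part W) (prim_part W').
Proof.
move=> thin [phi phiP eqW]; set l := diag_coef phi.
have l0 a : l a != 0 by exact: diag_coef_neq0.
have eq_prim : cyc_equiv (rescale l (prim_part W)) (prim_part W').
  move=> p; rewrite /ccoef.
  case chp: (chordless p); last first.
    rewrite !big1_seq // => q /andP[_ /chordless_cshifts chq];
      by rewrite /= chq chp ?mulr0.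
  transitivity (ccoef (phi W) p).
    apply: eq_big_seq => q /chordless_cshifts; rewrite chp => chq.
    rewrite /= chq (right_equivalence_no_shortcut phiP thin) //.
    exact: chordless_no_shortcut.
  rewrite eqW; apply: eq_big_seq => q /chordless_cshifts.
  by rewrite chp /= => ->.
have rP := rescale_right_equivalence l0.
split; exists (rescale l) => //.
by split=> // P; split=> /(rescale_primitive _ l0).
Qed.

End Algebra.

Local Close Scope ring_scope.

(** * Triangles sharing sides *)

Lemma ordS3 (i : 'I_3) : ordS (ordS (ordS i)) = i.
Proof. by case: i => [[|[|[|]]] ?] //; apply: val_inj. Qed.

Lemma ord_pred3 (i : 'I_3) : ord_pred i = ordS (ordS i).
Proof. by case: i => [[|[|[|]]] ?] //; apply: val_inj. Qed.

Lemma neq_ordS (i : 'I_3) : i != ordS i.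
Proof. by case: i => [[|[|[|]]] ?]. Qed.

Lemma neq_ord3 (i j : 'I_3) : i != j -> j = ordS i \/ i = ordS j.
Proof.
by case: i => [[|[|[|]]] ?] //; case: j => [[|[|[|]]] ?] // _;
  (left + right); apply: val_inj.
Qed.

Section Sides.
Variable T : gluing.
Hypothesis hloop : no_loop_arc T.
Hypothesis hval : forall c : tri T * 'I_3, 3 <= valence c.

Lemma next_corner_inj : injective (@next_corner T).
Proof.
move=> x y e; have e1 := congr1 fst e; have /ordS_inj e2 := congr1 snd e.
apply: (can_inj (@glueK T)); move: e1 => /= e1.
by rewrite (surjective_pairing (glue x)) e1 e2 -surjective_pairing.
Qed.

(** Gluing the side i to the next one identifies the corners i and i + 2, which
    are the endpoints of the third side. *)
Lemma no_self_glued (t : tri T) (i j : 'I_3) : glue (t, i) != (t, j).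
Proof.
wlog ij : i j / j = ordS i => [hwlog|].
  apply/eqP=> e; have ne : i != j.
    by apply: contraNneq (glue_neq (t, i)) => eij; rewrite e eij.
  case: (neq_ord3 ne) => [/hwlog/eqP // | /hwlog/eqP]; apply.
  by rewrite -e glueK.
apply/eqP=> e; have := hloop t (ordS j).
rewrite /same_marked_point fconnect_sym; last exact: next_corner_inj.
have <- : next_corner (t, i) = (t, ordS j) by rewrite /next_corner e.
by rewrite ij ordS3 fconnect1.
Qed.

(** Suppose that the sides i, i + 1 of t are glued to i', j' of t'. If j' is the
    side after i', turning twice around the corner i of t leads to i + 2, and
    the third side of t is a loop. If i' is the side after j', turning twice
    around the corner i + 1 of t leads back to it, and its valence is at most
    2. *)
Lemma no_two_common_sides (t t' : tri T) (i j i' j' : 'I_3) :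
  i != j -> glue (t, i) = (t', i') -> glue (t, j) = (t', j') -> False.
Proof.
wlog -> : i j i' j' / j = ordS i => [hwlog|].
  move=> ne ei ej; case: (neq_ord3 ne) => e; first exact: (hwlog i j i' j').
  by apply: (hwlog j i j' i') => //; rewrite eq_sym.
move=> _ ei ej.
have ne' : i' != j'.
  apply: contraNneq (neq_ordS i) => e.
  by move: ej; rewrite -e -ei => /(can_inj (@glueK T)) [->].
case: (neq_ord3 ne') => e'.
  have := hloop t (ordS (ordS i)).
  rewrite /same_marked_point fconnect_sym; last exact: next_corner_inj.
  have <- : next_corner (next_corner (t, i)) = (t, ordS (ordS i)).
    by rewrite {2}/next_corner ei /= -e' /next_corner -ej glueK.
  by rewrite ordS3 (fconnect_iter _ 2).
have := hval (t, ordS i).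
have e2 : next_corner (next_corner (t, ordS i)) = (t, ordS i).
  by rewrite {2}/next_corner ej /= -e' /next_corner -ei glueK.
have cyc : fcycle (@next_corner T) [:: (t, ordS i); next_corner (t, ordS i)].
  by rewrite /= e2 !eqxx.
rewrite leqNgt ltnS => /negP; apply.
by apply: (order_le_cycle cyc); rewrite mem_head.
Qed.

(** * Gluing of lattice points *)

Variable m : nat.
Implicit Types x y z : point T m.

(** Corners being excluded, a lattice point lies on at most one side. *)
Lemma coord_zero_uniq x i j : Defs.coord x i = 0 -> Defs.coord x j = 0 -> i = j.
Proof.
move=> xi xj; apply/eqP; apply/negPn/negP => ne.
case: x xi xj => t [p pP]; rewrite /Defs.coord /= => xi xj.
have /andP[/eqP sp /forallP hp] := pP.
have [l [li lj]] : exists l, l != i /\ l != j.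
  case: (neq_ord3 ne) => ->.
    by exists (ordS (ordS i)); case: (i) => [[|[|[|]]] ?].
  by exists (ordS (ordS j)); case: (j) => [[|[|[|]]] ?].
have := hp l; move: sp; rewrite (bigD1 l) //= big1 ?addn0 => [->|r rl].
  by rewrite eqxx.
suff [->|->] : r = i \/ r = j by [].
move: ne li lj rl; clear.
case: i => [[|[|[|]]] ?] //; case: j => [[|[|[|]]] ?] //;
 case: l => [[|[|[|]]] ?] //; case: r => [[|[|[|]]] ?] // _ _ _ _;
  (left + right); apply: val_inj; done.
Qed.

Lemma point_eq x y i : x.1 = y.1 ->
  Defs.coord x i = Defs.coord y i ->
  Defs.coord x (ordS i) = Defs.coord y (ordS i) ->
  Defs.coord x (ord_pred i) = Defs.coord y (ord_pred i) -> x = y.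
Proof.
case: x y => t p [t' q] /= <- e0 e1; rewrite ord_pred3 => e2.
congr (_, _); apply: val_inj; apply/ffunP => j; apply: val_inj.
case: (eqVneq j i) => [-> //|/neq_ord3[e|->] //].
by move: e2; rewrite e ordS3.
Qed.

(** [glued] is symmetric and relates each point to at most one other, so that
    gluing twice leads back to the same point. *)
Lemma glued_glued x y z : glued x y -> glued y z -> x = z.
Proof.
case/existsP=> i /existsP[j] /and5P[/eqP g1 /eqP xi /eqP yj /eqP c1 /eqP c2].
case/existsP=> j' /existsP[l] /and5P[/eqP g2 /eqP yj' /eqP zl /eqP c3 /eqP c4].
have jj' : j = j'.
  by apply: (can_inj (@ord_predK 3)); exact: coord_zero_uniq yj yj'.
move: g2; rewrite -jj' -g1 glueK => -[e1 il].
by apply: (@point_eq _ _ i) => //; congruence.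
Qed.

(** By the previous lemma, a chain of gluings can be shortened to at most one. *)
Lemma vertex_of_eq x y : vertex_of x = vertex_of y -> x = y \/ glued x y.
Proof.
case=> /setP/(_ y); rewrite !inE connect0 => /connectP[s].
elim: s x => [|z s IHs] x /= => [_ ->|/andP[xz zs] e]; first by left.
have [<-|zy] := IHs z zs e; first by right.
by left; exact: glued_glued xz zy.
Qed.

End Sides.

(** * Absence of parallel arrows *)

(** The j-th vertex of the black triangle is (a_i + 1)_i minus the j-th unit
    vector: the difference of the two vertices determines j, then either of
    them determines a. *)
Lemma black_vertex_edge_inj m (a a' : black_triangle m) (j j' : 'I_3) :
  black_vertex_fun a j = black_vertex_fun a' j' ->
  black_vertex_fun a (ordS j) = black_vertex_fun a' (ordS j') ->
  (a, j) = (a', j').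
Proof.
have coordE (b b' : black_triangle m) l l' :
    black_vertex_fun b l = black_vertex_fun b' l' ->
    forall i, val b i + (i != l) = val b' i + (i != l').
  by move=> e i; rewrite -!black_vertex_funE e.
move=> /coordE e1 /coordE e2.
have jj' : j = j'.
  apply/eqP; apply/negPn/negP => ne.
  have := e2 j; have := e1 j; rewrite eqxx ne neq_ordS /= addn0 => ->.
  by rewrite -addnA => /eqP; rewrite eqn_add2l; case: (j != _).
rewrite -jj'; congr (_, _); apply: val_inj; apply/ffunP => i; apply: val_inj.
by have /eqP := e1 i; rewrite -jj' eqn_add2r => /eqP.
Qed.

(** Corresponding endpoints of two parallel arrows are equal or glued. The two
    ends of an arrow never lie on the same side: in a black triangle the j-th
    coordinate can only vanish at the j-th vertex. So if both pairs are glued,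
    two triangles share two sides. *)
Lemma tri_quiver_thin (T : gluing) (m : nat) :
  no_loop_arc T -> (forall c, 3 <= valence (G := T) c) ->
  injective (fun a : qarr (tri_quiver T m) => (src a, tgt a)).
Proof.
move=> hloop hval [[t a] j] [[t' a'] j'] /= [].
set X := (t, _); set X' := (t', _) => es.
set Y := (t, _); set Y' := (t', _) => et.
have eX : X = X' \/ glued X X' by apply: vertex_of_eq; apply: val_inj.
have eY : Y = Y' \/ glued Y Y' by apply: vertex_of_eq; apply: val_inj.
have self (x y : point T m) : x.1 = y.1 -> ~ glued x y.
  move=> e /existsP[i /existsP[l /andP[]]].
  by rewrite e (negPf (no_self_glued hloop _ _ _)).
case: eX eY => [[tt' eX]|gX] [[tt'2 eY]|gY].
- by case: (black_vertex_edge_inj eX eY) => -> ->; rewrite tt'.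
- by case: (self Y Y' tt' gY).
- by case: (self X X' tt'2 gX).
case/existsP: gX => i /existsP[i'] /and5P[/eqP gi /eqP xi _ _ _].
case/existsP: gY => l /existsP[l'] /and5P[/eqP gl /eqP yl _ _ _].
suff il : i != l by case: (no_two_common_sides hloop hval il gi gl).
apply: contraTneq (neq_ordS j) => il; move: xi yl; rewrite -il.
rewrite /Defs.coord /X /Y /= !black_vertex_funE => /eqP + /eqP.
by rewrite !addn_eq0 !eqb0 !negbK => /andP[_ /eqP->] /andP[_ /eqP <-].
Qed.

Theorem corollary1p2 (k : fieldType) (hk : [pchar k]%R =i pred0)
    (g d : nat) (hd : 0 < d) (hgd : (2 - 2 * g%:Z - d%:Z < 0)%R)
    (T : gluing) (hT : ideal_triangulation g d T)
    (hloop : no_loop_arc T) (hval : forall c, 3 <= valence (G := T) c)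
    (m : nat) (hm : 1 <= m)
    (W W' : cpalg k (tri_quiver T m)) :
  generic W -> generic W' -> right_equivalent W W' ->
  right_equivalent (prim_part W) (prim_part W') /\
  same_primitive_class (prim_part W) (prim_part W').
Proof.
move=> _ _; apply: prim_part_right_equivalent.
exact: tri_quiver_thin.
Qed.
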